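(* Let $n=m\lambda$ with $m,\lambda$ positive integers and let $1\le d\le n$. (i) Given an $FPA_\lambda(n,d)$ of size $N$, there exists a $PA(n,d)$ of size $\lambda N$. In particular, $M_\lambda(n,d) \leq \frac{M(n,d)}{\lambda}$. (ii) Let $l$ be a positive divisor of $\lambda$. Given an $FPA_\lambda(n,d)$ of size $N$, there exists an $FPA_l(n,d)$ of size $\frac{\lambda}{l}N$. In particular, $M_\lambda(n,d) \leq \frac{l}{\lambda} M_l(n,d)$.
   Context: For $n=m\lambda$ (positive integers), a $\lambda$-permutation of length $n$ is an arrangement (sequence of length $n$) of the multiset consisting of $m$ distinct symbols, each repeated exactly $\lambda$ times. The distance between two $\lambda$-permutations is the Hamming distance, i.e. the number of positions in which they disagree. A frequency permutation array $FPA_\lambda(n,d)$ is a set $T$ of $\lambda$-permutations of length $n$ (on a common set of $m=n/\lambda$ symbols) such that any two distinct members of $T$ have distance at least $d$; its size is $|T|$. $M_\lambda(n,d)$ denotes the maximum size of an $FPA_\lambda(n,d)$. When $\lambda=1$ an $FPA_1(n,d)$ is called a permutation array $PA(n,d)$ (a set of permutations of $n$ symbols), and $M(n,d)=M_1(n,d)$. *)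

(* Defs.v *)
From mathcomp Require Import all_boot all_order all_algebra.
Set Implicit Arguments.
Unset Strict Implicit.
Unset Printing Implicit Defensive.

(* The alphabet S is an arbitrary finite type, so that arrays may be taken on
   any set of n / lam symbols. *)
Section FrequencyPermutationArrays.

Variables (n : nat) (S : finType).
Implicit Types (x y : n.-tuple S) (T : {set n.-tuple S}).

Definition hamming_dist x y : nat := #|[set i : 'I_n | tnth x i != tnth y i]|.

Definition freq_perm (lam : nat) x : bool := [forall s : S, count_mem s x == lam].

(* The cardinality condition on S follows from freq_perm as soon as T is
   nonempty; it is stated so that the empty array has the right alphabet too. *)
Definition FPA (lam d : nat) T : bool :=
  [&& #|S| * lam == n,
      [forall x in T, freq_perm lam x]
    & [forall x in T, forall y in T, (x != y) ==> (d <= hamming_dist x y)]].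

Definition PA (d : nat) T : bool := FPA 1 d T.

End FrequencyPermutationArrays.

(* The maximum is taken over the canonical alphabet with n / lam symbols;
   renaming symbols does not change the size of an array.  The definition is
   meaningful when 0 < lam and lam divides n, in which case the empty array is
   an FPA, so the maximum is over a nonempty family. *)
Definition maxFPA (lam n d : nat) : nat :=
  \max_(T : {set n.-tuple 'I_(n %/ lam)} | FPA lam d T) #|T|.

Definition maxPA (n d : nat) : nat := maxFPA 1 n d.

(* Main.v *)
Require Import Defs.
From mathcomp Require Import all_boot all_order all_algebra.
Import Order.TTheory GRing.Theory Num.Theory.

(** Write lam = q * l.  In a lam-permutation x, replace the k-th occurrence of
    the symbol s by the pair (s, k + i mod q), for each shift i modulo q.  Every
    pair then occurs exactly l times.  Forgetting the second component gives x
    back, so distinct words stay at distance at least d, while two different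
    shifts of the same word disagree in all n positions.  Hence every word yields
    q words.  Part (i) is the case l = 1. *)

(** Along the positions of [s], the number of earlier occurrences takes the values 0, 1, 2, ... once
    each. The induction is on the right end because appending a letter leaves every earlier prefix
    unchanged. *)
Lemma sum_occurrences (S : eqType) (s : S) (F : nat -> nat) (x : seq S) (x0 : S) :
  \sum_(p < size x | nth x0 x p == s) F (count_mem s (take p x)) =
  \sum_(k < count_mem s x) F k.
Proof.
elim/last_ind: x => [|x a IHx]; first by rewrite !big_ord0.
rewrite -cats1 count_cat size_cat /= addn0 addn1 big_mkcond big_ord_recr /=.
rewrite nth_cat ltnn subnn /= take_size_cat //.
under eq_bigr => p _ do rewrite nth_cat ltn_ord take_cat ltn_ord.
rewrite -big_mkcond /= IHx.
by case: eqP => _; rewrite /= ?addn1 ?big_ord_recr //= !addn0.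
Qed.

(** The range splits into [l] blocks of [q.+1] consecutive integers, and each block meets the
    residue [e] exactly once. *)
Lemma sum_residue (q l : nat) (e : 'I_q.+1) :
  \sum_(k < q.+1 * l) (inZp k == e) = l.
Proof.
elim: l => [|l IHl]; first by rewrite muln0 big_ord0.
rewrite mulnS addnC big_split_ord /= IHl -[RHS]addn1; congr (_ + _).
rewrite (bigD1 e) //= big1 => [|k /negPf k_neq].
  by rewrite addn0 -val_eqE /= mulnC modnMDl modn_small ?eqxx.
by rewrite -val_eqE /= mulnC modnMDl modn_small // val_eqE k_neq.
Qed.

Section Relabelling.

Variables (n : nat) (S : finType) (q : nat).

(** The modulus is written [q.+1] so that ['I_q.+1] carries addition modulo [q.+1]. Since [take p]
    stops before position [p], occurrences are numbered from 0. *)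
Definition shift_relabel (u : n.-tuple S * 'I_q.+1) : n.-tuple (S * 'I_q.+1) :=
  [tuple (tnth u.1 p, inZp (count_mem (tnth u.1 p) (take p u.1)) + u.2)%R
    | p < n].

Lemma freq_perm_shift_relabel (l : nat) (x : n.-tuple S) (i : 'I_q.+1) :
  freq_perm (q.+1 * l) x -> freq_perm l (shift_relabel (x, i)).
Proof.
move=> /forallP x_freq; apply/forallP => -[s c]; apply/eqP.
rewrite count_map -sum1_count big_enum_cond /= big_mkcond /=.
(* Indicator that occurrence [k] of [s] gets the label [c], that is, [k + i = c] modulo [q.+1]. *)
pose F k : nat := inZp k == (c - i)%R :> 'I_q.+1.
transitivity (\sum_(p < n | tnth x p == s) F (count_mem s (take p x))).
  rewrite [RHS]big_mkcond; apply: eq_bigr => p _.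
  rewrite /preim /= xpair_eqE; case: eqP => //= ->.
  by rewrite /F [in RHS]eq_sym GRing.subr_eq eq_sym; case: eqP.
have /= := sum_occurrences _ s F x s.
rewrite (eqP (x_freq s)) sum_residue size_tuple => <-.
by apply: eq_bigl => p; rewrite (tnth_nth s).
Qed.

Lemma hamming_dist_shift_relabel (x y : n.-tuple S) (i j : 'I_q.+1) :
  hamming_dist x y <= hamming_dist (shift_relabel (x, i)) (shift_relabel (y, j)).
Proof.
apply/subset_leq_card/subsetP => p; rewrite !inE !tnth_mktuple /=.
by rewrite xpair_eqE => /negPf->.
Qed.

Lemma hamming_dist_shift (x : n.-tuple S) (i j : 'I_q.+1) : i != j ->
  hamming_dist (shift_relabel (x, i)) (shift_relabel (x, j)) = n.
Proof.
move=> neq_ij; rewrite -[RHS]card_ord; apply: eq_card => p.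
rewrite !inE !tnth_mktuple /= xpair_eqE eqxx /=.
by rewrite (inj_eq (GRing.addrI _)).
Qed.

Lemma FPA_shift_relabel (l d : nat) (T : {set n.-tuple S}) : 0 < d <= n ->
  FPA (q.+1 * l) d T ->
  FPA l d (shift_relabel @: setX T setT)
  /\ #|shift_relabel @: setX T setT| = q.+1 * #|T|.
Proof.
move=> /andP[d_gt0 le_dn] /and3P[/eqP cardS /forall_inP Tfreq /forall_inP Tdist].
have dist_ge u v : u \in setX T setT -> v \in setX T setT -> u != v ->
    d <= hamming_dist (shift_relabel u) (shift_relabel v).
  case: u v => [x i] [y j]; rewrite !inE !andbT /= => Tx Ty.
  have [<-|neq_xy] := eqVneq x y.
    by rewrite xpair_eqE eqxx /= => /hamming_dist_shift->.
  move=> _; apply: leq_trans (hamming_dist_shift_relabel _ _ _ _).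
  by have /forall_inP/(_ y Ty)/implyP-> := Tdist x Tx.
split; last first.
  (* Injectivity comes from the distance bound: distinct pairs with equal images would be at
     distance 0, below [d]. *)
  rewrite card_in_imset ?cardsX ?cardsT ?card_ord 1?mulnC // => u v Xu Xv eq_uv.
  apply/eqP/contraT => /(dist_ge _ _ Xu Xv); rewrite eq_uv leqNgt.
  rewrite /hamming_dist (_ : [set _ | _] = set0) ?cards0 ?d_gt0 //.
  by apply/setP => p; rewrite !inE eqxx.
apply/and3P; split.
- by rewrite card_prod card_ord -mulnA cardS.
- apply/forall_inP => _ /imsetP[[x i] /setXP[Tx _] ->].
  exact/freq_perm_shift_relabel/Tfreq.
apply/forall_inP => _ /imsetP[u Xu ->]; apply/forall_inP => _ /imsetP[v Xv ->].
by apply/implyP => neq_uv; apply: dist_ge => //; apply: contraNneq neq_uv => ->.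
Qed.

End Relabelling.

(** Carries the relabelled array from the alphabet of pairs to the ordinals over which [maxFPA]
    ranges. Injectivity of [g] preserves disagreements; its inverse gives the frequency of each new
    symbol. *)
Lemma FPA_rename (n : nat) (S S' : finType) (g : S -> S') (lam d : nat)
    (T : {set n.-tuple S}) : bijective g ->
  FPA lam d T ->
  FPA lam d [set map_tuple g x | x in T]
  /\ #|[set map_tuple g x | x in T]| = #|T|.
Proof.
move=> g_bij /and3P[cardS /forall_inP Tfreq /forall_inP Tdist].
have g_inj := bij_inj g_bij; split; last first.
  by rewrite card_imset // => x y /(congr1 val)/(inj_map g_inj)/val_inj.
apply/and3P; split; first by rewrite -(bij_eq_card g_bij).
  apply/forall_inP => _ /imsetP[x /Tfreq/forallP x_freq ->].
  apply/forallP => s'; have [h _ hK] := g_bij.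
  rewrite -(hK s') count_map -(eqP (x_freq (h s'))).
  by apply/eqP/eq_count => s /=; rewrite (inj_eq g_inj).
apply/forall_inP => _ /imsetP[x Tx ->]; apply/forall_inP => _ /imsetP[y Ty ->].
apply/implyP => neq_gxy.
have /forall_inP/(_ y Ty)/implyP le_d := Tdist x Tx.
apply: leq_trans (le_d _) _; first by apply: contraNneq neq_gxy => ->.
apply/subset_leq_card/subsetP => p.
by rewrite !inE !tnth_map (inj_eq g_inj).
Qed.

Lemma FPA_refine (n lam l d : nat) (S : finType) (T : {set n.-tuple S}) :
    0 < d <= n -> 0 < lam -> 0 < l -> l %| lam -> FPA lam d T ->
  exists T' : {set n.-tuple 'I_(n %/ l)},
    FPA l d T' /\ #|T'| = lam %/ l * #|T|.
Proof.
move=> d_bounds lam_gt0 l_gt0 /dvdnP[q lamE].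
rewrite {}lamE mulnK // in lam_gt0 *.
case: q lam_gt0 => // q _ FPA_T.
have [FPA_X cardX] := FPA_shift_relabel _ _ _ _ _ _ d_bounds FPA_T.
(* Read off from the alphabet condition in [FPA], so it also holds for an empty array. *)
have cardS' : #|{: S * 'I_q.+1}| = n %/ l.
  by have /and3P[/eqP cardS _ _] := FPA_X; rewrite -[in RHS]cardS mulnK.
have g_bij : bijective (cast_ord cardS' \o @enum_rank _).
  apply: bij_comp; last exact: enum_rank_bij.
  by exists (cast_ord (esym cardS')); [apply: cast_ordK | apply: cast_ordKV].
have [FPA_T' cardT'] := FPA_rename _ _ _ _ _ _ _ g_bij FPA_X.
by eexists; split; [exact: FPA_T' | rewrite cardT'].
Qed.

Lemma maxFPA_refine (n lam l d : nat) :
    0 < d <= n -> 0 < lam -> 0 < l -> l %| lam ->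
  lam %/ l * maxFPA lam n d <= maxFPA l n d.
Proof.
move=> d_bounds lam_gt0 l_gt0 dvd_l.
have q_gt0 : 0 < lam %/ l by rewrite divn_gt0 // dvdn_leq.
(* Dividing by [lam %/ l] isolates the maximum, which can then be bounded one array at a time. *)
rewrite mulnC -leq_divRL //; apply/bigmax_leqP => T FPA_T.
have [T' [FPA_T' cardT']] :=
  FPA_refine _ _ _ _ _ _ d_bounds lam_gt0 l_gt0 dvd_l FPA_T.
by rewrite leq_divRL // mulnC -cardT'; apply: leq_bigmax_cond.
Qed.

Theorem theorem4p1 (n m lam d : nat) (hm : 0 < m) (hlam : 0 < lam)
    (hn : n = m * lam) (hd : 1 <= d <= n) :
  ((forall (N : nat) (S : finType) (T : {set n.-tuple S}),
      FPA lam d T -> #|T| = N ->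
      exists P : {set n.-tuple 'I_n}, PA d P /\ #|P| = lam * N)
   /\ ((maxFPA lam n d)%:R <= (maxPA n d)%:R / lam%:R :> rat)%R)
  /\
  (forall l : nat, 0 < l -> l %| lam ->
     (forall (N : nat) (S : finType) (T : {set n.-tuple S}),
        FPA lam d T -> #|T| = N ->
        exists T' : {set n.-tuple 'I_(n %/ l)},
          FPA l d T' /\ #|T'| = (lam %/ l) * N)
     /\ ((maxFPA lam n d)%:R <= l%:R / lam%:R * (maxFPA l n d)%:R :> rat)%R).
Proof.
have refine l : 0 < l -> l %| lam ->
     (forall (N : nat) (S : finType) (T : {set n.-tuple S}),
        FPA lam d T -> #|T| = N ->
        exists T' : {set n.-tuple 'I_(n %/ l)},
          FPA l d T' /\ #|T'| = (lam %/ l) * N)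
     /\ ((maxFPA lam n d)%:R <= l%:R / lam%:R * (maxFPA l n d)%:R :> rat)%R.
  move=> l_gt0 dvd_l; split=> [_ S T FPA_T <-|]; first exact: FPA_refine.
  rewrite mulrAC ler_pdivlMr ?ltr0n // -!natrM ler_nat.
  (* Writing the factor [lam] as [lam %/ l * l] lets [l] cancel on both sides. *)
  by rewrite -{2}(divnK dvd_l) mulnA [l * _]mulnC leq_mul2r [X in X <= _]mulnC
    maxFPA_refine ?orbT.
split=> //; have [] := refine 1 isT (dvd1n lam).
by rewrite !divn1 mulrAC mul1r; split.
Qed.
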